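(* Let $\mathbf{P}(s,t,u)=\big(a(s,t,u),b(s,t,u),c(s,t,u),d(s,t,u)\big)$ be a rational parametric surface with no base point, and let $f(x,y,z,w,s,t,u)=0$ be any moving surface following it. If $\mathbf{X}_0=(x_0,y_0,z_0,w_0)$, with $w_0\neq0$, is an $r$-fold singular point on the surface, then the system $$w_0\,a(s,t,u)-x_0\,d(s,t,u)=w_0\,b(s,t,u)-y_0\,d(s,t,u)=w_0\,c(s,t,u)-z_0\,d(s,t,u)=f(x_0,y_0,z_0,w_0,s,t,u)=0$$ has exactly $r$ intersection points (counting multiplicity).
   Context: Rational parametric surface: $\mathbf{P}(s,t)=(a(s,t),b(s,t),c(s,t),d(s,t))$ in homogeneous coordinates of projective 3-space, with $a,b,c,d\in\mathbb{R}[s,t]$, $\gcd(a,b,c,d)=1$, whose image is a surface; $\mathbf{P}(s,t,u)$ denotes its homogeneous form, where $a,b,c,d$ are homogenized with $u$ to homogeneous polynomials of a common degree $n$. Base points are the points $(s,t,u)\in\mathbb{P}^2(\mathbb{C})$ (possibly complex, possibly at infinity) at which $a=b=c=d=0$; ''no base point'' means there are none. Moving surface: a family of surfaces $f(x,y,z,w,s,t)=0$ parametrized by $(s,t)$, where $f$ is a real polynomial, homogeneous in $(x,y,z,w)$. It follows $\mathbf{P}(s,t)$ if $f(a(s,t),b(s,t),c(s,t),d(s,t),s,t)\equiv0$. $f(x,y,z,w,s,t,u)$ denotes the homogeneous form of $f(x,y,z,w,s,t)$, obtained by homogenizing in the parameters $(s,t)$ with $u$. Intersection multiplicity of several planar curves: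 let $C_1,\dots,C_v$ be given in $\mathbb{P}^2(\mathbb{C})$ by homogeneous equations $f_1(s,t,u)=0,\dots,f_v(s,t,u)=0$, and let $p$ be an isolated common point. Let $R_p=\mathcal{O}_{\mathbb{P}^2,p}$, let $\widetilde f_i$ be a local equation of $C_i$ at $p$, and $I_p=\langle\widetilde f_1,\dots,\widetilde f_v\rangle\subset R_p$. The intersection multiplicity at $p$ is $m(p)=e(I_p,R_p)$, the (Hilbert–Samuel) multiplicity, i.e. the number $e$ with $\dim_{\mathbb{C}}(R_p/I_p^{\,l+1})=\frac{e}{2!}l^2+(\text{lower order terms in } l)$ for $l\gg0$. A system $f_1=\dots=f_v=0$ has $N$ intersection points counting multiplicity if its common zero set in $\mathbb{P}^2(\mathbb{C})$ is finite and $\sum_p m(p)=N$ over the common zeros $p$. $r$-fold singular point (surface without base points): $\mathbf{X}_0=(x_0,y_0,z_0,w_0)$ with $w_0\neq0$ is an $r$-fold singular point of $\mathbf{P}$ if the system $w_0a-x_0d=w_0b-y_0d=w_0c-z_0d=0$ has exactly $r$ intersection points in the $(s,t,u)$-plane, counting multiplicity. *)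

(* Defs.v *)
From HB Require Import structures.
From mathcomp Require Export all_boot all_order all_algebra.
From mathcomp Require Export mpoly complex reals.

Set Implicit Arguments.
Unset Strict Implicit.
Unset Printing Implicit Defensive.

Import GRing.Theory.
Local Open Scope ring_scope.

(* Points of projective space P^n over a field C are represented by nonzero   *)
(* row vectors of homogeneous coordinates, taken up to [proportional].        *)
Definition proportional (C : fieldType) n (p q : 'rV[C]_n) : Prop :=
  exists2 c : C, c != 0 & q = c *: p.

Section Ideals.

Variables (K : fieldType) (A : K -> Prop).

(* A is meant to be a subring of K, and the ideals below are ideals of A.     *)
Definition ideal_generated (S : K -> Prop) (x : K) : Prop :=
  exists (n : nat) (r g : 'I_n -> K),
    (forall i, A (r i) /\ S (g i)) /\ x = \sum_(i < n) r i * g i.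

Definition ideal_power (I : K -> Prop) (l : nat) : K -> Prop :=
  ideal_generated (fun x => exists g : 'I_l -> K,
    (forall i, I (g i)) /\ x = \prod_(i < l) g i).

End Ideals.

Section IntersectionMultiplicity.

Variable C : fieldType.

Notation form := {mpoly C[3]}.
Notation K := {fraction {mpoly C[3]}}.

(* The function field of P^2 is the field of degree-0 fractions inside K.     *)
Definition local_ring (p : 'rV[C]_3) (x : K) : Prop :=
  exists (k : nat) (F G : form),
    [/\ F \is k.-homog, G \is k.-homog, G.@[p 0] != 0 &
        x = tofrac F / tofrac G].

(* Dividing the form f by any form G of the same degree that does not vanish  *)
(* at p gives a local equation of the curve f = 0 at p; any two of them       *)
(* differ by a unit of the local ring.                                        *)
Definition local_equation (p : 'rV[C]_3) (f : form) (x : K) : Prop :=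
  exists (k : nat) (G : form),
    [/\ f \is k.-homog, G \is k.-homog, G.@[p 0] != 0 &
        x = tofrac f / tofrac G].

Definition intersection_ideal (fs : seq form) (p : 'rV[C]_3) : K -> Prop :=
  ideal_generated (local_ring p)
    (fun x => exists2 f, f \in fs & local_equation p f x).

(* dim_C (A / J) = N : the classes of some b_1, ..., b_N form a C-basis.      *)
Definition quotient_dim (A J : K -> Prop) (N : nat) : Prop :=
  exists b : 'I_N -> K, (forall i, A (b i)) /\
    forall x, A x -> exists! c : {ffun 'I_N -> C},
      J (x - \sum_(i < N) tofrac (c i)%:MP * b i).

Definition hilbert_samuel_multiplicity (A I : K -> Prop) (e : nat) : Prop :=
  exists (c1 c0 : rat) (h : nat -> nat) (l0 : nat),
    forall l, (l0 <= l)%N ->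
      quotient_dim A (ideal_power A I l.+1) (h l) /\
      (h l)%:R = e%:R / 2`!%:R * l%:R ^+ 2 + c1 * l%:R + c0 :> rat.

Definition intersection_multiplicity (fs : seq form) (p : 'rV[C]_3) :=
  hilbert_samuel_multiplicity (local_ring p) (intersection_ideal fs p).

Definition common_zero (fs : seq form) (p : 'rV[C]_3) : Prop :=
  forall f, f \in fs -> f.@[p 0] = 0.

(* The family p lists each point of the common zero locus exactly once.       *)
Definition has_intersection_points (fs : seq form) (N : nat) : Prop :=
  exists (v : nat) (p : 'I_v -> 'rV[C]_3) (m : 'I_v -> nat),
    [/\ forall i, p i != 0 /\ common_zero fs (p i),
        forall q, q != 0 -> common_zero fs q -> exists i, proportional (p i) q,
        forall i j, proportional (p i) (p j) -> i = j,
        forall i, intersection_multiplicity fs (p i) (m i) &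
        (\sum_(i < v) m i)%N = N].

End IntersectionMultiplicity.

(* Homogenization to degree n with the new last variable u; it is only        *)
(* meaningful when n is at least the total degree (msize p).-1 of p.          *)
Definition homogenize (R : nzRingType) k n (p : {mpoly R[k]}) :
    {mpoly R[k.+1]} :=
  \sum_(m <- msupp p)
    p@_m *: 'X_[(mnmwiden m + U_(ord_max) *+ (n - mdeg m))%MM].

Section RationalSurface.

Variable R : realType.

Notation affine := {mpoly R[2]}.
Notation C := R[i].

Definition to_complex k : {mpoly R[k]} -> {mpoly C[k]} :=
  map_mpoly (real_complex R).

Definition param_degree (P : 4.-tuple affine) : nat :=
  \max_(i < 4) (msize (tnth P i)).-1.

Definition hom_param (P : 4.-tuple affine) : 4.-tuple {mpoly R[3]} :=
  map_tuple (homogenize (param_degree P)) P.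

Definition param_point (P : 4.-tuple affine) (p : 'rV[C]_3) : 'rV[C]_4 :=
  \row_i (to_complex (tnth (hom_param P) i)).@[p 0].

Definition no_base_point (P : 4.-tuple affine) : Prop :=
  forall p : 'rV[C]_3, p != 0 -> param_point P p != 0.

(* The surface parametrized by P: the Zariski closure in P^3(C) of the image, *)
(* which is the image itself when there is no base point.                     *)
Definition on_surface (P : 4.-tuple affine) (X : 'rV[C]_4) : Prop :=
  X != 0 /\
  forall (k : nat) (G : {mpoly C[4]}), G \is k.-homog ->
    (forall p, p != 0 -> param_point P p != 0 ->
       G.@[param_point P p 0] = 0) ->
    G.@[X 0] = 0.

Definition image_is_surface (P : 4.-tuple affine) : Prop :=
  exists (k : nat) (F : {mpoly C[4]}),
    [/\ (0 < k)%N, F != 0, F \is k.-homog &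
        forall X, X != 0 -> (on_surface P X <-> F.@[X 0] = 0)].

Definition gcd_is_one (P : 4.-tuple affine) : Prop :=
  forall h : affine, (forall i, exists q, tnth P i = q * h) ->
    h \is a GRing.unit.

Definition rational_parametric_surface (P : 4.-tuple affine) : Prop :=
  gcd_is_one P /\ image_is_surface P.

(* A moving surface is a polynomial in x, y, z, w whose coefficients are      *)
(* polynomials in s, t.                                                       *)
Notation moving := {mpoly affine[4]}.

Definition moving_surface (f : moving) : Prop := exists k, f \is k.-homog.

Definition follows (f : moving) (P : 4.-tuple affine) : Prop :=
  f.@[tnth P] = 0.

Definition moving_degree (f : moving) : nat :=
  \max_(m <- msupp f) (msize f@_m).-1.

Definition hom_moving (f : moving) : {mpoly {mpoly R[3]}[4]} :=
  map_mpoly (homogenize (moving_degree f)) f.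

(* f(x0, y0, z0, w0, s, t, u) as a form in s, t, u.                           *)
Definition moving_at (f : moving) (X : 'rV[C]_4) : {mpoly C[3]} :=
  (map_mpoly (@to_complex 3) (hom_moving f)).@[fun i => (X 0 i)%:MP].

Definition point4 (x y z w : C) : 'rV[C]_4 :=
  \row_i tnth [tuple x; y; z; w] i.

Definition point_system (a b c d : affine) (x0 y0 z0 w0 : C) :
    seq {mpoly C[3]} :=
  let h p := to_complex (homogenize (param_degree [tuple a; b; c; d]) p) in
  [:: w0 *: h a - x0 *: h d; w0 *: h b - y0 *: h d; w0 *: h c - z0 *: h d].

Definition fold_singular_point (r : nat) (a b c d : affine)
    (x0 y0 z0 w0 : C) : Prop :=
  w0 != 0 /\ has_intersection_points (point_system a b c d x0 y0 z0 w0) r.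

End RationalSurface.

(* Main.v *)
From HB Require Import structures.
Require Import Defs.
From mathcomp Require Import boolp ssrcomplements.
Import GRing.Theory.
Local Open Scope ring_scope.

Set Implicit Arguments.
Unset Strict Implicit.
Unset Printing Implicit Defensive.

(** Adding the equation of the moving surface changes neither the common zeros
    nor the ideals whose multiplicities are summed, because the new form
    h = f(X0, s, t, u) already lies in the ideal of the old system at each of
    its common zeros.

    Homogenization, at degrees high enough to be meaningful, is additive and
    multiplicative, so f(P(s,t), s, t) = 0 becomes the identity
    F(P(s,t,u), s, t, u) = 0 between forms
    ([homogenize_moving_surface]).  At a common zero p of the system
    w0 P_i - X0_i d the value d(p) is nonzero: otherwise w0 P(p) = d(p) X0 = 0
    and p would be a base point.  Hence d is a unit near p, and in the local
    ring of p the point w0 P / d is congruent to X0 modulo the ideal I of the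
    old system, the differences of coordinates being local equations of that
    system.  A polynomial with coefficients in the local ring respects
    congruences ([congruent_meval]), and F is homogeneous in its first group of
    variables, so modulo I
      F(X0) = F(w0 P / d) = (w0 / d)^e F(P) = 0
    after division by a form G that makes the coefficients of F rational
    functions of degree zero ([moving_form_in_ideal]).  Evaluating the same
    computation at p shows that h vanishes there ([moving_form_root]).  So the
    old list of points and the old multiplicities serve for the new system
    ([has_intersection_points_rcons]). *)

(** * Homogenization *)

(** Summing over all the exponents below a common bound, instead of over the
    support of p, gives index sets that agree for different polynomials. *)
Lemma homogenizeE (R : nzRingType) k n (p : {mpoly R[k]}) d :
  (msize p <= d)%N ->
  homogenize n p = \sum_(m : 'X_{1..k < d})
    p@_m *: 'X_[(mnmwiden m + U_(ord_max) *+ (n - mdeg m))%MM].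
Proof.
move=> le_pd; set I : subFinType _ := 'X_{1..k < d}.
rewrite /homogenize (big_mksub I) ?msupp_uniq //=; first last.
  by move=> x /msize_mdeg_lt /leq_trans; apply.
rewrite big_rmcond //= => j /memN_msupp_eq0 ->.
by rewrite scale0r.
Qed.

Lemma homogenize_is_zmod_morphism (R : nzRingType) k n :
  zmod_morphism (@homogenize R k n).
Proof.
move=> p q; pose d := maxn (msize (p - q)) (maxn (msize p) (msize q)).
rewrite !(@homogenizeE _ _ _ _ d) ?leq_max ?leqnn ?orbT // -sumrB.
by apply: eq_bigr => m _; rewrite mcoeffB scalerBl.
Qed.

HB.instance Definition _ (R : nzRingType) k n :=
  GRing.isZmodMorphism.Build {mpoly R[k]} {mpoly R[k.+1]} (@homogenize R k n)
    (@homogenize_is_zmod_morphism R k n).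

Lemma homogenize_monomial (R : nzRingType) k n (c : R) (m : 'X_{1..k}) :
  homogenize n (c *: 'X_[m]) =
  c *: 'X_[(mnmwiden m + U_(ord_max) *+ (n - mdeg m))%MM].
Proof.
have [->|c_neq0] := eqVneq c 0; first by rewrite !scale0r raddf0.
rewrite (@homogenizeE _ _ _ _ (mdeg m).+1); last first.
  by rewrite (leq_trans (msizeZ_le _ _)) // msizeX.
pose m' := BMultinom (leqnn (mdeg m).+1).
rewrite (bigD1 m') //= mcoeffZ mcoeffX eqxx mulr1 big1 ?addr0 // => i i_neq.
rewrite mcoeffZ mcoeffX (_ : (m == i) = false) ?mulr0 ?scale0r //.
by apply: contraNF i_neq => /eqP mi; apply/eqP/val_inj.
Qed.

(** The degree bounds are what makes the truncated subtractions in the exponents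
    of the new variable add up. *)
Lemma homogenizeM (R : comNzRingType) k n1 n2 (p q : {mpoly R[k]}) :
  (msize p <= n1.+1)%N -> (msize q <= n2.+1)%N ->
  homogenize (n1 + n2) (p * q) = homogenize n1 p * homogenize n2 q.
Proof.
move=> le_p le_q; rewrite mpolyME raddf_sum /= big_allpairs /homogenize.
rewrite mulr_suml big_seq [RHS]big_seq; apply: eq_bigr => m1 m1p.
rewrite mulr_sumr big_seq [RHS]big_seq; apply: eq_bigr => m2 m2q /=.
have := leq_trans (msize_mdeg_lt m1p) le_p; rewrite ltnS => le_m1.
have := leq_trans (msize_mdeg_lt m2q) le_q; rewrite ltnS => le_m2.
rewrite -/(homogenize _ _) homogenize_monomial -scalerAr -scalerAl scalerA mulrC.
rewrite -mpolyXD; congr (_ *: 'X_[_]); apply/mnmP=> i.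
rewrite mnmwidenD mdegD !mnmDE !mulmnE subnDA addnACA.
by rewrite -mulnDr -subnDA subnDA -addnBAC // addnBA.
Qed.

Lemma msizeM_leS (R : nzRingType) k n1 n2 (p q : {mpoly R[k]}) :
  (msize p <= n1.+1)%N -> (msize q <= n2.+1)%N ->
  (msize (p * q) <= (n1 + n2).+1)%N.
Proof.
move=> le_p le_q; rewrite msizeE; apply/bigmax_leqP_seq => m mpq _ /=.
have /allpairsP[[m1 m2] /= [m1p m2q ->]] := msuppM_le mpq.
rewrite ltnS mdegD leq_add // -ltnS.
  exact: leq_trans (msize_mdeg_lt m1p) le_p.
exact: leq_trans (msize_mdeg_lt m2q) le_q.
Qed.

(** The size bound travels with the equation because [homogenizeM] asks for it
    at each multiplication. *)
Lemma homogenize_monomial_eval (R : comNzRingType) k N n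
    (P : 'I_N -> {mpoly R[k]}) (m : 'X_{1..N}) :
  (forall i, msize (P i) <= n.+1)%N ->
  (msize (\prod_i P i ^+ m i) <= (n * mdeg m).+1)%N /\
  homogenize (n * mdeg m) (\prod_i P i ^+ m i) =
    \prod_i homogenize n (P i) ^+ m i.
Proof.
move=> le_P; rewrite mdegE big_distrr /=.
pose ok d (p : {mpoly R[k]}) q := (msize p <= d.+1)%N /\ homogenize d p = q.
have ok1 : ok 0 1 1.
  rewrite /ok msize1 -[X in homogenize _ X]scale1r -mpolyX0.
  by rewrite homogenize_monomial mnmwiden0 mulm0n addm0 scale1r mpolyX0.
have okM d1 d2 p1 p2 q1 q2 :
    ok d1 p1 q1 -> ok d2 p2 q2 -> ok (d1 + d2)%N (p1 * p2) (q1 * q2).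
  by move=> [s1 <-] [s2 <-]; split; [exact: msizeM_leS|exact: homogenizeM].
apply: (big_rec3 ok) => // i d p q _; apply/okM.
elim: (m i) => [|e IHe]; first by rewrite muln0 !expr0.
by rewrite mulnS !exprS; apply: okM IHe.
Qed.

(** Each term of F has degree at most D in its coefficient and degree e in P, so
    that all the terms homogenize at the same degree D + n e; at one fixed
    degree homogenization is additive, and the identity F(P) = 0 is carried
    over as a whole. *)
Lemma homogenize_moving_surface (R : comNzRingType) k N n D e
    (F : {mpoly {mpoly R[k]}[N]}) (P : 'I_N -> {mpoly R[k]}) :
  F \is e.-homog -> (forall m, msize F@_m <= D.+1)%N ->
  (forall i, msize (P i) <= n.+1)%N -> F.@[P] = 0 ->
  (map_mpoly (homogenize D) F).@[fun i => homogenize n (P i)] = 0.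
Proof.
move=> homF le_F le_P FP0.
suff ->: (map_mpoly (homogenize D) F).@[fun i => homogenize n (P i)] =
  homogenize (D + n * e) F.@[P] by rewrite FP0 raddf0.
rewrite [in RHS]mevalE /map_mpoly /mmap !raddf_sum /= big_seq [RHS]big_seq.
apply: eq_bigr => m mF; rewrite mevalM mevalC mmap1_id mevalX.
have [le_Pm <-] := homogenize_monomial_eval m le_P.
by rewrite -homogenizeM // -(dhomog_mf homF mF).
Qed.

Lemma homogenize_dhomog (R : nzRingType) k n (p : {mpoly R[k]}) :
  (msize p <= n.+1)%N -> homogenize n p \is n.-homog.
Proof.
move=> le_p; rewrite /homogenize big_seq; apply: rpred_sum => m mp.
rewrite dhomogZ // dhomogX /= mdegD mdegMn mdeg1 mul1n.
rewrite (_ : mdeg (mnmwiden m) = mdeg m); last first.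
  rewrite !mdegE big_ord_recr /= mnmwiden_ordmax addn0.
  by apply: eq_bigr => i _; rewrite mnmwiden_widen.
by rewrite subnKC // -ltnS (leq_trans (msize_mdeg_lt mp)).
Qed.

(** * Congruences modulo an ideal of a subring *)

Definition subsemiring (K : fieldType) (A : K -> Prop) : Prop :=
  [/\ A 0, A 1, forall x y, A x -> A y -> A (x + y)
    & forall x y, A x -> A y -> A (x * y)].

Lemma ideal_generated0 (K : fieldType) (A S : K -> Prop) :
  ideal_generated A S 0.
Proof.
exists 0%N, (fun=> 0), (fun=> 0); split; first by case.
by rewrite big_ord0.
Qed.

Lemma ideal_generatedD (K : fieldType) (A S : K -> Prop) x y :
  ideal_generated A S x -> ideal_generated A S y -> ideal_generated A S (x + y).
Proof.
move=> [n1 [r1 [g1 [rg1 ->]]]] [n2 [r2 [g2 [rg2 ->]]]].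
pose glue (u : 'I_n1 -> K) (v : 'I_n2 -> K) i :=
  match split i with inl j => u j | inr j => v j end.
exists (n1 + n2)%N, (glue r1 r2), (glue g1 g2); split.
  by move=> i; rewrite /glue; case: split.
rewrite big_split_ord /=; congr (_ + _); apply: eq_bigr => i _; rewrite /glue.
  by rewrite (unsplitK (inl i)).
by rewrite (unsplitK (inr i)).
Qed.

Lemma ideal_generatedMl (K : fieldType) (A S : K -> Prop) a x :
  subsemiring A -> A a -> ideal_generated A S x -> ideal_generated A S (a * x).
Proof.
move=> [_ _ _ AM] Aa [n [r [g [rg ->]]]].
exists n, (fun i => a * r i), g; split.
  by move=> i; have [Ar Sg] := rg i; split=> //; apply: AM.
by rewrite mulr_sumr; apply: eq_bigr => i _; rewrite mulrA.
Qed.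

Lemma ideal_generated_gen (K : fieldType) (A S : K -> Prop) x :
  subsemiring A -> S x -> ideal_generated A S x.
Proof.
move=> [_ A1 _ _] Sx; exists 1%N, (fun=> 1), (fun=> x); split=> //.
by rewrite big_ord1 mul1r.
Qed.

(** Comparing two ideals only requires looking at generators; used to drop a
    redundant generator. *)
Lemma ideal_generated_least (K : fieldType) (A S T : K -> Prop) :
  subsemiring A -> (forall x, S x -> ideal_generated A T x) ->
  forall x, ideal_generated A S x -> ideal_generated A T x.
Proof.
move=> semA subST x [n [r [g [rg ->]]]].
elim/big_ind: _ => [|y z|i _].
- exact: ideal_generated0.
- exact: ideal_generatedD.
- by have [Ar /subST Tg] := rg i; apply: ideal_generatedMl.
Qed.

(** Membership of x and y in A is part of the relation so that it is stable under
    products: x x' - y y' = x (x' - y') + y' (x - y). *)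
Definition congruent (K : fieldType) (A S : K -> Prop) (x y : K) : Prop :=
  [/\ A x, A y & ideal_generated A S (x - y)].

Lemma congruentD (K : fieldType) (A S : K -> Prop) x1 y1 x2 y2 :
  subsemiring A -> congruent A S x1 y1 -> congruent A S x2 y2 ->
  congruent A S (x1 + x2) (y1 + y2).
Proof.
move=> [_ _ AD _] [Ax1 Ay1 J1] [Ax2 Ay2 J2]; split; try exact: AD.
by rewrite opprD addrACA; apply: ideal_generatedD.
Qed.

Lemma congruentM (K : fieldType) (A S : K -> Prop) x1 y1 x2 y2 :
  subsemiring A -> congruent A S x1 y1 -> congruent A S x2 y2 ->
  congruent A S (x1 * x2) (y1 * y2).
Proof.
move=> semA [Ax1 Ay1 J1] [Ax2 Ay2 J2].
have [_ _ _ AM] := semA; split; try exact: AM.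
rewrite (_ : _ - _ = x1 * (x2 - y2) + y2 * (x1 - y1)); last first.
  by rewrite !mulrBr [y2 * x1]mulrC [y2 * y1]mulrC addrA subrK.
by apply: ideal_generatedD; apply: ideal_generatedMl.
Qed.

Lemma congruent_refl (K : fieldType) (A S : K -> Prop) x :
  A x -> congruent A S x x.
Proof. by move=> Ax; split=> //; rewrite subrr; apply: ideal_generated0. Qed.

Lemma congruent_meval (K : fieldType) (A S : K -> Prop) N (F : {mpoly K[N]})
    (u v : 'I_N -> K) :
  subsemiring A -> (forall m, A F@_m) ->
  (forall i, congruent A S (u i) (v i)) -> congruent A S F.@[u] F.@[v].
Proof.
move=> semA AF uv; have [A0 A1 _ _] := semA; rewrite !mevalE.
elim/big_ind2: _ => [|x1 x2 y1 y2|m _]; first exact: congruent_refl.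
  exact: congruentD.
apply: congruentM => //; first exact: congruent_refl.
elim/big_ind2: _ => [|x1 x2 y1 y2|i _]; first exact: congruent_refl.
  exact: congruentM.
elim: (m i) => [|e IHe]; first exact: congruent_refl.
by rewrite !exprS; apply: congruentM.
Qed.

Lemma local_ring_subsemiring (C : fieldType) (p : 'rV[C]_3) :
  subsemiring (local_ring p).
Proof.
split.
- exists 0%N, 0, 1; rewrite dhomog1 rpred0 meval1 oner_eq0.
  by rewrite tofrac0 mul0r.
- exists 0%N, 1, 1; rewrite dhomog1 meval1 oner_eq0.
  by rewrite tofrac1 divr1.
- move=> _ _ [k1 [F1 [G1 [hF1 hG1 nz1 ->]]]] [k2 [F2 [G2 [hF2 hG2 nz2 ->]]]].
  have G1_neq0 : tofrac G1 != 0.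
    by rewrite tofrac_eq0; apply: contraNneq nz1 => ->; rewrite meval0.
  have G2_neq0 : tofrac G2 != 0.
    by rewrite tofrac_eq0; apply: contraNneq nz2 => ->; rewrite meval0.
  exists (k1 + k2)%N, (F1 * G2 + F2 * G1), (G1 * G2); split.
  + by apply: rpredD; [|rewrite addnC]; apply: dhomogM.
  + exact: dhomogM.
  + by rewrite mevalM mulf_neq0.
  + by rewrite (addf_div _ _ G1_neq0 G2_neq0) -!tofracM -tofracD.
- move=> _ _ [k1 [F1 [G1 [hF1 hG1 nz1 ->]]]] [k2 [F2 [G2 [hF2 hG2 nz2 ->]]]].
  exists (k1 + k2)%N, (F1 * F2), (G1 * G2); split; try exact: dhomogM.
  + by rewrite mevalM mulf_neq0.
  + by rewrite !tofracM mulf_div.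
Qed.

(** * Evaluation of forms *)

Lemma meval_dhomog (R : comNzRingType) N e (F : {mpoly R[N]}) c
    (v : 'I_N -> R) :
  F \is e.-homog -> F.@[fun i => c * v i] = c ^+ e * F.@[v].
Proof.
move=> homF; rewrite !mevalE mulr_sumr big_seq [RHS]big_seq.
apply: eq_bigr => m mF; rewrite mulrCA; congr (_ * _).
under eq_bigr => i _ do rewrite exprMn.
by rewrite big_split /= prodrXr -mdegE (dhomog_mf homF mF).
Qed.

Lemma map_mpoly_meval (R S : comNzRingType) (phi : {rmorphism R -> S}) N
    (F : {mpoly R[N]}) (v : 'I_N -> R) :
  (map_mpoly phi F).@[fun i => phi (v i)] = phi F.@[v].
Proof.
rewrite [in RHS]mevalE /map_mpoly /mmap !raddf_sum /=; apply: eq_bigr => m _.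
rewrite mevalM mevalC mmap1_id mevalX rmorphM rmorph_prod /=.
by congr (_ * _); apply: eq_bigr => i _; rewrite rmorphXn.
Qed.

Lemma map_mpoly_dhomog (R S : nzRingType) (phi : {additive R -> S}) N e
    (F : {mpoly R[N]}) :
  F \is e.-homog -> map_mpoly phi F \is e.-homog.
Proof.
move=> homF; apply/dhomogP => m; rewrite mcoeff_msupp mcoeff_map_mpoly => nz.
apply: (dhomog_mf homF); rewrite mcoeff_msupp.
by apply: contraNneq nz => ->; rewrite raddf0.
Qed.

(** * Moving surfaces evaluated at a point *)

Lemma mevalC_dhomog (R : comNzRingType) k N D (F : {mpoly {mpoly R[k]}[N]})
    (X : 'I_N -> R) :
  (forall m, F@_m \is D.-homog) -> F.@[fun i => (X i)%:MP] \is D.-homog.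
Proof.
move=> homF; rewrite mevalE; apply: rpred_sum => m _; rewrite -[D]addn0.
apply: dhomogM; first exact: homF.
under eq_bigr => i _ do rewrite -rmorphXn.
by rewrite -rmorph_prod /= -[X in X \is _]mulr1 mul_mpolyC dhomogZ ?dhomog1.
Qed.

(** At p the vectors P_l(p) X and X_l P(p) agree, so by homogeneity P_l(p)^e F(X)
    and X_l^e F(P) take the same value there, which is 0. *)
Lemma moving_form_root (C : fieldType) k N e (F : {mpoly {mpoly C[k]}[N]})
    (P : 'I_N -> {mpoly C[k]}) (X : 'I_N -> C) (l : 'I_N) (p : 'I_k -> C) :
  F \is e.-homog -> F.@[P] = 0 -> (P l).@[p] != 0 ->
  (forall i, X l * (P i).@[p] = X i * (P l).@[p]) ->
  F.@[fun i => (X i)%:MP].@[p] = 0.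
Proof.
move=> homF FP0 Pl_neq0 prop.
have homFp : map_mpoly (meval p) F \is e.-homog by apply: map_mpoly_dhomog.
have Fp (v : 'I_N -> {mpoly C[k]}) :
  F.@[v].@[p] = (map_mpoly (meval p) F).@[fun i => (v i).@[p]].
  by rewrite (map_mpoly_meval (meval p)).
have /eqP : (P l).@[p] ^+ e * F.@[fun i => (X i)%:MP].@[p] = 0.
  rewrite Fp -(meval_dhomog _ _ homFp).
  rewrite (@meval_eq _ _ _ (fun i => X l * (P i).@[p])); last first.
    by move=> i; rewrite /= mevalC mulrC prop.
  by rewrite (meval_dhomog _ _ homFp) -Fp FP0 meval0 mulr0.
by rewrite mulf_eq0 expf_eq0 (negPf Pl_neq0) andbF => /eqP.
Qed.

(** The heart of the proof.  In the local ring at p, where P_l is a unit, the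
    vector (X_l / P_l) P is congruent to X modulo the forms X_l P_i - X_i P_l,
    so F takes congruent values at both; homogeneity makes the first one 0. *)
Lemma moving_form_in_ideal (C : fieldType) N n D e
    (F : {mpoly {mpoly C[3]}[N]}) (P : 'I_N -> {mpoly C[3]}) (X : 'I_N -> C)
    (l : 'I_N) (fs : seq {mpoly C[3]}) (p : 'rV[C]_3) (x : {fraction {mpoly C[3]}}) :
  F \is e.-homog -> (forall m, F@_m \is D.-homog) ->
  (forall i, P i \is n.-homog) -> F.@[P] = 0 -> (P l).@[p 0] != 0 ->
  (forall i, i != l -> X l *: P i - X i *: P l \in fs) ->
  local_equation p F.@[fun i => (X i)%:MP] x -> intersection_ideal fs p x.
Proof.
move=> homF homFm homP FP0 Pl_neq0 fsE [D' [G [homh homG G_neq0 ->]]].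
(* The degree attached to a local equation is determined only for a nonzero
   form; the zero form is treated apart. *)
have [->|h_neq0] := eqVneq F.@[fun i => (X i)%:MP] 0.
  by rewrite tofrac0 mul0r; apply: ideal_generated0.
have eqD : D' = D := dhomog_uniq h_neq0 homh (mevalC_dhomog X homFm).
rewrite {}eqD {D' homh h_neq0} in homG *.
pose A := local_ring p.
pose S x := exists2 f, f \in fs & local_equation p f x.
have semA : subsemiring A := local_ring_subsemiring p.
have PlF_neq0 : tofrac (P l) != 0.
  by rewrite tofrac_eq0; apply: contraNneq Pl_neq0 => ->; rewrite meval0.
have A_const c : A (tofrac c%:MP).
  exists 0%N, c%:MP, 1; rewrite dhomog1 meval1 oner_eq0 tofrac1 divr1.
  by rewrite -[c%:MP]mulr1 mul_mpolyC dhomogZ ?dhomog1.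
(* Dividing by G moves the coefficients of F into the local ring. *)
pose FK := (tofrac G)^-1 *: map_mpoly (@tofrac _) F.
pose c := tofrac (X l)%:MP / tofrac (P l).
have [] := @congruent_meval _ A S _ FK (fun i => c * tofrac (P i))
  (fun i => tofrac (X i)%:MP) semA.
- move=> m; exists D, F@_m, G; split=> //.
  by rewrite mcoeffZ mcoeff_map_mpoly mulrC.
- move=> i; have A_quot : A (c * tofrac (P i)).
    rewrite /c mulrAC -mulrA; have [_ _ _ AM] := semA; apply: AM => //.
    by exists n, (P i), (P l).
  split=> //; have [->|il] := eqVneq i l.
    by rewrite /c divfK // subrr; apply: ideal_generated0.
  apply: ideal_generated_gen => //.
  exists (X l *: P i - X i *: P l); first exact: fsE.
  exists n, (P l); split=> //; first by rewrite rpredB ?rpredZ.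
  rewrite /c -!mul_mpolyC tofracB !tofracM mulrBl mulfK //.
  by rewrite mulrAC.
- move=> _ _; rewrite !mevalZ (meval_dhomog _ _ (map_mpoly_dhomog (@tofrac _) homF)).
  rewrite !map_mpoly_meval FP0 raddf0 !mulr0 sub0r mulrC => J.
  rewrite -[X in _ X]opprK -mulN1r; apply: ideal_generatedMl => //.
  by have := A_const (-1); rewrite mpolyCN mpolyC1 tofracN tofrac1.
Qed.

(** * Enlarging a system of curves *)

Lemma intersection_ideal_rcons (C : fieldType) (fs : seq {mpoly C[3]}) g
    (p : 'rV[C]_3) :
  (forall x, local_equation p g x -> intersection_ideal fs p x) ->
  intersection_ideal (rcons fs g) p = intersection_ideal fs p.
Proof.
move=> gfs; have semA := local_ring_subsemiring p.
apply/predeqP => x; split; apply: ideal_generated_least => // {}x [f].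
  rewrite mem_rcons inE => /orP[/eqP-> /gfs //|ffs fx].
  by apply: ideal_generated_gen => //; exists f.
move=> ffs fx; apply: ideal_generated_gen => //; exists f => //.
by rewrite mem_rcons inE ffs orbT.
Qed.

Lemma has_intersection_points_rcons (C : fieldType) (fs : seq {mpoly C[3]}) g
    r :
  (forall p : 'rV[C]_3, p != 0 -> common_zero fs p -> g.@[p 0] = 0 /\
     forall x, local_equation p g x -> intersection_ideal fs p x) ->
  has_intersection_points fs r -> has_intersection_points (rcons fs g) r.
Proof.
move=> gfs [v [p [m [pz p_all p_inj pm sum_m]]]]; exists v, p, m; split=> //.
- move=> i; have [pi_neq0 zi] := pz i; split=> // f.
  rewrite mem_rcons inE => /orP[/eqP->|/zi //].
  by have [] := gfs _ pi_neq0 zi.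
- move=> q q_neq0 zq; apply: p_all => // f ffs; apply: zq.
  by rewrite mem_rcons inE ffs orbT.
- move=> i; have [pi_neq0 zi] := pz i.
  rewrite /intersection_multiplicity intersection_ideal_rcons; first exact: pm.
  by have [] := gfs _ pi_neq0 zi.
Qed.

(** If P_l vanished at a common zero p, then X_l P_i(p) = X_i P_l(p) = 0 for all i
    and p would be a base point; this puts every common zero within reach of the
    two local statements above. *)
Lemma has_intersection_points_moving_form (C : fieldType) N n D e
    (F : {mpoly {mpoly C[3]}[N]}) (P : 'I_N -> {mpoly C[3]}) (X : 'I_N -> C)
    (l : 'I_N) (fs : seq {mpoly C[3]}) r :
  F \is e.-homog -> (forall m, F@_m \is D.-homog) ->
  (forall i, P i \is n.-homog) -> F.@[P] = 0 ->
  (forall p : 'rV[C]_3, p != 0 -> \row_i (P i).@[p 0] != 0) ->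
  X l != 0 -> (forall i, i != l -> X l *: P i - X i *: P l \in fs) ->
  has_intersection_points fs r ->
  has_intersection_points (rcons fs F.@[fun i => (X i)%:MP]) r.
Proof.
move=> homF homFm homP FP0 no_base Xl_neq0 fsE.
apply: has_intersection_points_rcons => p p_neq0 p_zero.
have prop i : X l * (P i).@[p 0] = X i * (P l).@[p 0].
  have [->//|/fsE/p_zero/eqP] := eqVneq i l.
  by rewrite mevalB !mevalZ subr_eq0 => /eqP.
have Pl_neq0 : (P l).@[p 0] != 0.
  apply: contra (no_base p p_neq0) => /eqP Pl0; apply/eqP/rowP => i.
  apply/eqP; rewrite !mxE; have /eqP := prop i.
  by rewrite Pl0 mulr0 mulf_eq0 (negPf Xl_neq0).
split; first exact: moving_form_root homF FP0 Pl_neq0 prop.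
move=> x; exact: moving_form_in_ideal homF homFm homP FP0 Pl_neq0 fsE.
Qed.

Theorem theorem8 (R : realType) (a b c d : {mpoly R[2]})
    (f : {mpoly {mpoly R[2]}[4]}) (x0 y0 z0 w0 : R[i]) (r : nat) :
  rational_parametric_surface [tuple a; b; c; d] ->
  no_base_point [tuple a; b; c; d] ->
  moving_surface f ->
  follows f [tuple a; b; c; d] ->
  on_surface [tuple a; b; c; d] (point4 x0 y0 z0 w0) ->
  fold_singular_point r a b c d x0 y0 z0 w0 ->
  has_intersection_points
    (rcons (point_system a b c d x0 y0 z0 w0)
           (moving_at f (point4 x0 y0 z0 w0))) r.
Proof.
set T := [tuple a; b; c; d]; set X := point4 _ _ _ _.
move=> _ no_base [e homf] fT0 _ [w0_neq0].
have size_T i : (msize (tnth T i) <= (param_degree T).+1)%N.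
  rewrite -(leq_add2r 1) !addn1 ltnS; apply: leq_trans (leqSpred _) _.
  by rewrite ltnS (leq_bigmax i).
have size_f m : (msize f@_m <= (moving_degree f).+1)%N.
  have [mf|/memN_msupp_eq0->] := boolP (m \in msupp f); last by rewrite msize0.
  apply: leq_trans (leqSpred _) _; rewrite ltnS.
  exact: (@leq_bigmax_seq _ _ xpredT (fun m => (msize f@_m).-1)).
pose P i := to_complex (tnth (hom_param T) i).
pose F := map_mpoly (@to_complex R 3) (hom_moving f).
have homP i : P i \is (param_degree T).-homog.
  by rewrite map_mpoly_dhomog // tnth_map homogenize_dhomog.
have homF : F \is e.-homog by rewrite !map_mpoly_dhomog.
have homFm m : F@_m \is (moving_degree f).-homog.
  by rewrite !mcoeff_map_mpoly map_mpoly_dhomog // homogenize_dhomog.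
have FP0 : F.@[P] = 0.
  rewrite /F map_mpoly_meval (@meval_eq _ _ _
    (fun i => homogenize (param_degree T) (tnth T i))).
    by rewrite /hom_moving (homogenize_moving_surface homf) // raddf0.
  by move=> i; rewrite tnth_map.
apply: (has_intersection_points_moving_form (l := ord_max)
          homF homFm homP FP0 no_base); rewrite !mxE !(tnth_nth 0) //.
move=> i; rewrite /P !tnth_map !mxE !(tnth_nth 0) !inE.
by case: i => [[|[|[|[|i]]]] lti] //= _; apply/or3P;
  [apply: Or31 | apply: Or32 | apply: Or33].
Qed.
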